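(* Let $G$ and $H$ be connected graphs, each on $n$ vertices, with minimum degrees $\delta(G)$ and $\delta(H)$, and let $\delta=\min\{\delta(G),\delta(H)\}$. If $\delta\geq 2^{12n/\delta+15}$, then $G\Box H$ is of Class 0, i.e. $\pi(G\Box H)$ equals the number of vertices of $G\Box H$.
   Context: Pebbling: a pebbling configuration on a graph $G$ is a distribution of pebbles to the vertices of $G$. A pebbling step removes two pebbles from a vertex $v$ that has at least two pebbles and places one pebble on a neighbor of $v$. A configuration is $r$-solvable if some sequence of pebbling steps places a pebble on the vertex $r$, and solvable if it is $r$-solvable for every vertex $r$. The pebbling number $\pi(G)$ is the least integer such that every configuration of that many pebbles on $G$ is solvable. A graph $G$ is of Class 0 if $\pi(G)=|V(G)|$. The Cartesian product $G\Box H$ has vertex set $V(G)\times V(H)$, with $(g,h)$ adjacent to $(g',h')$ iff either $g=g'$ and $hh'\in E(H)$, or $h=h'$ and $gg'\in E(G)$. *)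

(* Defs.v *)
From HB Require Import structures.
From mathcomp Require Import all_boot all_order all_algebra.
From mathcomp Require Import reals exp.

Set Implicit Arguments.
Unset Strict Implicit.
Unset Printing Implicit Defensive.

Record sgraph := SGraph {
  vertex :> finType;
  adj : rel vertex;
  adj_sym : symmetric adj;
  adj_irrefl : irreflexive adj
}.

Definition connected_graph (G : sgraph) : Prop :=
  0 < #|G| /\ forall x y : G, connect (@adj G) x y.

Definition degree (G : sgraph) (x : G) : nat := #|[set y | adj x y]|.

(* Every degree is smaller than #|G|, so the default value #|G| of the
   iterated minimum is only attained on the graph without vertices. *)
Definition min_degree (G : sgraph) : nat :=
  \big[minn/#|G|]_(x : G) degree x.

Section CartesianProduct.
Variables G H : sgraph.

Definition cart_adj : rel (G * H) := fun p q =>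
  ((p.1 == q.1) && adj p.2 q.2) || ((p.2 == q.2) && adj p.1 q.1).

Lemma cart_adj_sym : symmetric cart_adj.
Proof.
move=> p q; rewrite /cart_adj (eq_sym p.1) (eq_sym p.2).
by rewrite (adj_sym p.1) (adj_sym p.2).
Qed.

Lemma cart_adj_irrefl : irreflexive cart_adj.
Proof. by move=> p; rewrite /cart_adj !adj_irrefl !andbF. Qed.

Definition cart_prod : sgraph := SGraph cart_adj_sym cart_adj_irrefl.

End CartesianProduct.

Section Pebbling.
Variable G : sgraph.

Definition config := {ffun G -> nat}.

Definition num_pebbles (c : config) : nat := \sum_(x : G) c x.

Definition pebble_move (c : config) (u v : G) : config :=
  [ffun x => if x == u then c x - 2 else if x == v then c x + 1 else c x].

Definition pebble_step : rel config := fun c c' =>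
  [exists u, exists v, [&& adj u v, 2 <= c u & c' == pebble_move c u v]].

Definition solvable_at (r : G) (c : config) : Prop :=
  exists2 s : seq config, path pebble_step c s & 0 < last c s r.

Definition solvable (c : config) : Prop := forall r : G, solvable_at r c.

Definition all_solvable (k : nat) : Prop :=
  forall c : config, num_pebbles c = k -> solvable c.

Definition is_pebbling_number (k : nat) : Prop :=
  all_solvable k /\ forall m : nat, all_solvable m -> k <= m.

End Pebbling.

Definition class0 (G : sgraph) : Prop := is_pebbling_number G #|G|.

(* Main.v *)
(* Fix a root [r] and a configuration [c] of [#|V|] pebbles. For an empty
   vertex [x], the big vertices (two pebbles or more) that reach [x] by a walk
   of length at most [M] through nonempty vertices can send pebbles along a
   breadth-first tree; with weights [2 ^ - level] at least
   [2 ^ - M * \sum_v (c v - 1)] pebbles arrive at [x]. If [c] is not solvable at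
   [r], fewer than [2 ^ D] pebbles can be gathered anywhere, where [D] bounds the
   diameter. As the total surplus [\sum_v (c v - 1)] is the number of empty
   vertices, double counting yields a big vertex [b] that sees a set [F] of fewer
   than [2 ^ (M + D)] empty vertices. For [M = D + 2] this is at most the minimum
   degree, so some row next to [b] and some column next to [r] avoid [F]; going
   along them leads from [b] to [r] in at most [M] steps outside [F]. The first
   empty vertex on this walk is seen by [b], hence is [r], and [b] can send a
   pebble to [r]. Finally [D] is at most [6 n / delta] by packing disjoint
   neighbourhoods along the layers of a breadth-first search. *)

Require Import Defs.
From mathcomp Require Import all_boot all_order all_algebra.
From mathcomp Require Import reals exp.
From mathcomp Require Import zify.

Import Order.TTheory GRing.Theory Num.Theory.

Set Implicit Arguments.
Unset Strict Implicit.
Unset Printing Implicit Defensive.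

(** * Balls reached by constrained walks, and the diameter bound *)

Section Balls.
Variable G : sgraph.
Implicit Types (P : pred G) (x y u v : G).

(* [P] constrains every vertex of the walk to [x] except [x] itself. *)
Fixpoint ball P j x : {set G} :=
  if j is j'.+1 then
    ball P j' x :|: [set v | P v & [exists u in ball P j' x, adj v u]]
  else [set x].
#[global] Arguments ball : simpl never.

Lemma ball0 P x : ball P 0 x = [set x].
Proof. by []. Qed.

Lemma ballS P j x : ball P j.+1 x =
  ball P j x :|: [set v | P v & [exists u in ball P j x, adj v u]].
Proof. by []. Qed.

Lemma ball_center P j x : x \in ball P j x.
Proof. by elim: j => [|j IH]; rewrite ?ball0 ?ballS inE // IH. Qed.

Lemma ballW P i j x : i <= j -> ball P i x \subset ball P j x.
Proof.
move=> /subnK <-; elim: (j - i) => [|k IH]; first by rewrite add0n.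
by rewrite addSn ballS; apply: subset_trans IH (subsetUl _ _).
Qed.

Lemma ball_step P j x u v :
  P v -> adj v u -> u \in ball P j x -> v \in ball P j.+1 x.
Proof.
move=> Pv avu uB; rewrite ballS !inE Pv; apply/orP; right.
by apply/existsP; exists u; rewrite uB.
Qed.

Lemma ballSP P j x v : v \in ball P j.+1 x ->
  v \in ball P j x \/ exists u, [/\ P v, adj v u & u \in ball P j x].
Proof.
rewrite ballS !inE => /orP[|/andP[Pv /existsP[u /andP[uB avu]]]]; first by left.
by right; exists u.
Qed.

Lemma ball_path P j x v : v \in ball P j x ->
  exists s, [/\ path (@adj G) v s, last v s = x & size s <= j].
Proof.
elim: j v => [|j IH] v; first by rewrite ball0 inE => /eqP ->; exists [::].
case/ballSP => [/IH[s [? ? /leqW ?]]|[u [_ avu /IH[s [ps ls ss]]]]].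
  by exists s.
by exists (u :: s); rewrite /= avu.
Qed.

(** The vertex [y] is the first on the walk that fails [P]; everything before it satisfies [P], so
    [b] lies in its ball. The end [r] is not tested. *)
Lemma path_ball P b s r : path (@adj G) b (rcons s r) ->
  b \in ball P (size s).+1 r \/
  exists y, [/\ y \in b :: s, ~~ P y & b \in ball P (size s).+1 y].
Proof.
elim: s b => [|u s IH] b /=.
  rewrite andbT => abr; case: (boolP (P b)) => Pb.
    by left; apply: ball_step Pb abr _; rewrite ball_center.
  by right; exists b; rewrite mem_head (ball_center _ 1).
case/andP=> abu /IH {}IH; case: (boolP (P b)) => Pb; last first.
  by right; exists b; rewrite mem_head (ball_center _ (size s).+2).
case: IH => [uB|[y [ys Py uB]]]; [left|right; exists y].
  exact: ball_step Pb abu uB.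
by rewrite in_cons ys orbT; split=> //; apply: ball_step Pb abu uB.
Qed.

(** The level of [v] is the least radius whose ball contains [v]; the walk step that put [v] there
    leads to a vertex of smaller level. *)
Lemma ball_level P M x : exists lev : G -> nat,
  {in ball P M x, forall v, lev v <= M /\
     (v != x -> P v /\
       exists u, [/\ u \in ball P M x, adj v u & lev u < lev v])}.
Proof.
exists (fun v => find (fun j => v \in ball P j x) (iota 0 M.+1)) => v vB.
have levP u j : j <= M -> u \in ball P j x ->
    find (fun j => u \in ball P j x) (iota 0 M.+1) <= j.
  move=> jM uB; rewrite leqNgt; apply/negP => /(before_find 0).
  by rewrite nth_iota ?add0n ?uB // ltnS.
split=> [|vx]; first exact: levP.
set l := find _ _; have lM : l <= M by apply: levP.
have : v \in ball P l x.
  have /(nth_find 0) : has (fun j => v \in ball P j x) (iota 0 M.+1).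
    by apply/hasP; exists M => //; rewrite mem_iota add0n ltnSn.
  by rewrite -/l nth_iota ?add0n // ltnS.
case El: l lM => [|k] kM; first by rewrite ball0 inE (negPf vx).
case/ballSP=> [/levP|[u [Pv avu uB]]].
  by move=> /(_ (ltnW kM)); rewrite -/l El ltnn.
split=> //; exists u; split=> //; last exact: levP (ltnW kM) uB.
exact: subsetP (ballW _ _ (ltnW kM)) _ uB.
Qed.

(** Every three further layers contain a whole neighbourhood disjoint from the earlier ball, hence
    [d] new vertices. *)
Lemma ball_diameter d : connected_graph G -> 0 < d ->
  (forall x, d <= degree x) ->
  forall x y, y \in ball predT (3 * (#|G| %/ d)) x.
Proof.
move=> [_ conn] d0 degG x y.
have sub_nbr j v : v \in ball predT j x ->
    [set u | adj v u] \subset ball predT j.+1 x.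
  move=> vB; apply/subsetP => u; rewrite inE adj_sym => auv.
  exact: ball_step auv vB.
(* The second alternative would give more than [#|G|] vertices. *)
suff [/eqP ->|] : ball predT (3 * (#|G| %/ d)) x == setT \/
    (#|G| %/ d).+1 * d <= #|ball predT (3 * (#|G| %/ d)).+1 x|.
- by rewrite inE.
- move=> /leq_trans /(_ (max_card _)).
  by rewrite leqNgt ltn_ceil.
elim: (#|G| %/ d) => [|t IH].
  right; rewrite mul1n; apply: leq_trans (degG x) (subset_leq_card _).
  exact/sub_nbr/ball_center.
have [|nT] := eqVneq (ball predT (3 * t.+1) x) setT; [by left|right].
have {IH} le_t : t.+1 * d <= #|ball predT (3 * t).+1 x|.
  case: IH => // /eqP T; case/eqP: nT; apply/eqP; rewrite -subTset -T.
  by apply: ballW; lia.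
(* If layer [3 * t + 3] were empty, the ball would be closed under adjacency and contain everything
   by connectedness. *)
have [v vB vNB] : exists2 v, v \in ball predT (3 * t).+3 x
                   & v \notin ball predT (3 * t).+2 x.
  apply/subsetPn; apply: contra nT => closed.
  have -> : 3 * t.+1 = (3 * t).+3 by lia.
  rewrite -subTset; apply/subsetP => w _.
  have /connectP[s ps ->] := conn x w.
  elim/last_ind: s ps => [|s u IHs]; first by rewrite ball_center.
  rewrite rcons_path last_rcons => /andP[/IHs/(subsetP closed) lB alu].
  by apply: ball_step _ _ lB => //; rewrite adj_sym.
have disj : [disjoint ball predT (3 * t).+1 x & [set u | adj v u]].
  rewrite disjoint_sym; apply/pred0P => u /=; apply/negP; rewrite inE.
  by case/andP=> avu /(ball_step (P := predT) isT avu) /(negP vNB).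
have -> : (3 * t.+1).+1 = (3 * t).+4 by lia.
rewrite mulSn addnC; apply: leq_trans (leq_add le_t (degG v)) _.
rewrite /degree -cardsUI.
have := disj; rewrite -setI_eq0 => /eqP ->; rewrite cards0 addn0.
apply: subset_leq_card; rewrite subUset (sub_nbr _ _ vB) andbT.
by apply: ballW; lia.
Qed.

End Balls.

(** * Pebbling moves, weights and counting *)

Section Moves.
Variable G : sgraph.
Implicit Types (c : config G) (x y u v r : G).

Lemma adj_neq u v : adj u v -> u != v.
Proof. by apply: contraTneq => ->; rewrite adj_irrefl. Qed.

Lemma sum_move c u v (w : G -> nat) : adj u v -> 2 <= c u ->
  \sum_x w x * pebble_move c u v x + 2 * w u = \sum_x w x * c x + w v.
Proof.
move=> auv cu.
have pick y k : k * w y = \sum_x w x * (k * (x == y)).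
  rewrite (bigD1 y) //= eqxx big1 ?addn0 => [|i /negPf->]; lia.
rewrite pick -[w v]mul1n pick -!big_split; apply: eq_bigr => x _ /=.
rewrite -!mulnDr; congr (_ * _); rewrite ffunE.
have := adj_neq auv; case: (eqVneq x u) => [->|xu] => [/negPf ->|_] /=.
  lia.
case: (x == v) => /=; lia.
Qed.

Lemma num_pebbles_move c u v : adj u v -> 2 <= c u ->
  num_pebbles (pebble_move c u v) < num_pebbles c.
Proof.
move=> auv cu; have := sum_move (fun=> 1) auv cu.
rewrite /num_pebbles; under eq_bigr do rewrite mul1n.
by under [in RHS]eq_bigr do rewrite mul1n; lia.
Qed.

Lemma move_step c u v : adj u v -> 2 <= c u ->
  pebble_step c (pebble_move c u v).
Proof.
by move=> auv cu; apply/existsP; exists u; apply/existsP; exists v; apply/and3P.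
Qed.

(* A move towards lower level does not decrease the weight, so the moves can be
   repeated until every vertex of [S] other than [x] has at most one pebble. *)
Lemma collect (S : {set G}) x (lev : G -> nat) M c :
  {in S, forall v, lev v <= M /\
    (v != x -> exists u, [/\ u \in S, adj v u & lev u < lev v])} ->
  exists2 s, path (@pebble_step G) c s &
    \sum_(v in S) 2 ^ (M - lev v) * c v <=
      2 ^ M * last c s x + \sum_(v in S | v != x) 2 ^ (M - lev v).
Proof.
move=> levS; have [k] := ubnP (num_pebbles c); elim: k c => // k IH c ck.
have [/existsP[v /and3P[vS vx cv]]|/existsPn none] :=
    boolP [exists v, [&& v \in S, v != x & 1 < c v]].
  have [levM /(_ vx)[u [uS avu lt_uv]]] := levS v vS.
  case: (IH (pebble_move c v u)) => [|s ps le_s].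
    exact: leq_trans (num_pebbles_move avu cv) _.
  exists (pebble_move c v u :: s); first by rewrite /= move_step.
  apply: leq_trans le_s.
  have weightE (c' : config G) : \sum_(y in S) 2 ^ (M - lev y) * c' y =
      \sum_y (y \in S) * 2 ^ (M - lev y) * c' y.
    rewrite big_mkcond; apply: eq_bigr => y _.
    by case: (y \in S); rewrite ?mul1n.
  have := sum_move (fun y => (y \in S) * 2 ^ (M - lev y)) avu cv.
  rewrite -!weightE.
  rewrite uS vS !mul1n -expnS.
  have : 2 ^ (M - lev v).+1 <= 2 ^ (M - lev u) by rewrite leq_exp2l //; lia.
  lia.
exists [::] => //=; rewrite big_mkcond [in leqRHS]big_mkcond /=.
rewrite (bigD1 x) //= [in leqRHS](bigD1 x) //= eqxx andbF add0n.
apply: leq_add.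
  by case: ifP => // _; rewrite leq_mul2r leq_pexp2l ?leq_subr ?orbT.
apply: leq_sum => v vx; rewrite vx andbT; case: ifP => // vS.
have := none v; rewrite vS vx /= -leqNgt => cv.
by rewrite -[leqRHS]muln1 leq_mul2l cv orbT.
Qed.

Lemma collect_ball c x M :
  exists2 s, path (@pebble_step G) c s &
    \sum_(v in ball (fun v => 0 < c v) M x | v != x) (c v - 1) <=
      2 ^ M * last c s x.
Proof.
have [lev levP] := ball_level (fun v => 0 < c v) M x.
have [|s ps le_s] := @collect (ball (fun v => 0 < c v) M x) x lev M c.
  by move=> v /levP[le_M vP]; split=> // /vP[].
exists s => //.
(* Each [v != x] of the ball carries a pebble, so its weight [w >= 1] satisfies
   [(c v - 1) + w <= w * c v]; the added weights match the leftover term of [collect]. *)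
rewrite -(leq_add2r (\sum_(v in ball (fun v => 0 < c v) M x | v != x)
                       2 ^ (M - lev v))).
apply: leq_trans le_s; rewrite -big_split /=.
rewrite big_mkcond [leqRHS]big_mkcond; apply: leq_sum => v _ /=.
case: ifP => [/andP[vB vx]|_ //]; rewrite vB.
have [_ /(_ vx)[cv _]] := levP v vB.
have : 0 < 2 ^ (M - lev v) by rewrite expn_gt0.
nia.
Qed.

Lemma solvable_at_reach r c s : path (@pebble_step G) c s ->
  solvable_at r (last c s) -> solvable_at r c.
Proof.
move=> ps [t pt lt]; exists (s ++ t); first by rewrite cat_path ps.
by rewrite last_cat.
Qed.

Lemma solvable_at_path c y s : path (@adj G) y s -> 2 ^ size s <= c y ->
  solvable_at (last y s) c.
Proof.
elim: s y c => [|u s IH] y c /=; first by move=> _ cy; exists [::].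
case/andP=> ayu ps cy; have uy := adj_neq ayu.
(* Emptying [y] onto [u] is collecting with levels 0 at [u] and 1 at [y]: at least half of the
   pebbles on [y], rounded down, arrive at [u]. *)
have [|t pt] := @collect [set y; u] u (fun v => v != u : nat) 1 c.
  move=> v vS; split=> [|vu]; first by case: (v != u).
  have {vS} -> : v = y by move: vS; rewrite !inE (negPf vu) orbF => /eqP.
  by exists u; rewrite !inE eqxx orbT uy.
rewrite big_setU1 ?inE //= big_set1 eqxx uy.
rewrite (big_pred1 y) => [|v]; last first.
  rewrite !inE /=; case: (eqVneq v y) => [->|_]; first by rewrite uy.
  by rewrite orFb andbN.
move=> /= lt; apply: solvable_at_reach pt _; apply: IH ps _.
rewrite uy subnn subn0 expn0 expn1 in lt; move: cy lt; rewrite expnS; lia.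
Qed.

(* Double counting of the pairs (empty vertex [x], vertex in its ball): the
   surplus [c v - 1], which truncation makes 0 at an empty [v], sums up to the
   number of empty vertices. *)
Lemma big_vertex_few_zeros c M K :
    num_pebbles c = #|G| -> (exists r, c r = 0) ->
  (exists x s, path (@pebble_step G) c s /\ K <= last c s x) \/
  exists2 b, 1 < c b &
    #|[set x | (c x == 0) && (b \in ball (fun v => 0 < c v) M x)]| < 2 ^ M * K.
Proof.
move=> cG [r cr]; set B := ball _ M.
have [/existsP[x /andP[/eqP cx le_x]]|/existsPn ltx] := boolP [exists x,
    (c x == 0) && (2 ^ M * K <= \sum_(v in B x) (c v - 1))].
  left; have [s ps le_s] := collect_ball c x M; exists x, s; split=> //.
  rewrite -(leq_pmul2l (expn_gt0 2 M)) (leq_trans le_x) // (leq_trans _ le_s) //.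
  by rewrite (bigD1 x) ?ball_center //= cx.
right.
have surplus : \sum_v (c v - 1) = \sum_(x | c x == 0) 1.
  apply/eqP; rewrite -(eqn_add2r #|G|) -{2}cG -sum1_card /num_pebbles.
  rewrite big_mkcond [in X in _ == X]big_mkcond -!big_split; apply/eqP.
  by apply: eq_bigr => v _ /=; case: (c v) => [|k] //=; lia.
have lt : \sum_(x | c x == 0) \sum_(v in B x) (c v - 1) <
    2 ^ M * K * \sum_(x | c x == 0) 1.
  (* The empty vertex [r] is split off to make the inequality strict. *)
  rewrite big_distrr /= (bigD1 r) ?cr // [ltnRHS](bigD1 r) ?cr //= -addSn.
  have {}ltx x : c x == 0 -> \sum_(v in B x) (c v - 1) < 2 ^ M * K * 1.
    by move=> cx; have := ltx x; rewrite cx /= -ltnNge muln1.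
  apply: leq_add; first by apply: ltx; rewrite cr.
  by apply: leq_sum => x /andP[/ltx/ltnW].
have [/existsP[b /andP[cb Fb]]|/existsPn none] := boolP [exists b, (1 < c b) &&
    (#|[set x | (c x == 0) && (b \in B x)]| < 2 ^ M * K)].
  by exists b.
have exch : \sum_(x | c x == 0) \sum_(v in B x) (c v - 1) =
    \sum_v (c v - 1) * #|[set x | (c x == 0) && (v \in B x)]|.
  rewrite (exchange_big_dep predT) //=; apply: eq_bigr => v _.
  by rewrite sum_nat_const mulnC cardsE.
move: lt; rewrite exch -surplus big_distrr /= ltnNge => /negP[].
apply: leq_sum => v _; rewrite mulnC; have := none v; rewrite negb_and -!leqNgt.
case/orP => [|le_F]; last by rewrite leq_mul2l le_F orbT.
by rewrite -subn_eq0 => /eqP ->.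
Qed.

(** With one pebble on each of the first [m] vertices no move is possible, and vertex number [m]
    stays empty. *)
Lemma all_solvable_lower m : all_solvable G m -> #|G| <= m.
Proof.
move=> solv; rewrite leqNgt; apply/negP => mG.
pose r := enum_val (Ordinal mG).
pose c : config G := [ffun x => (enum_rank x < m : nat)].
have : num_pebbles c = m.
  rewrite /num_pebbles (reindex _ (onW_bij _ (@enum_val_bij G))) /=.
  under eq_bigr do rewrite ffunE enum_valK.
  rewrite -(big_mkord predT (fun i => (i < m : nat))).
  rewrite (big_cat_nat (n := m)) //=; last exact: ltnW.
  rewrite big_nat_cond (eq_bigr (fun=> 1)); last by move=> i /andP[/andP[_ ->]].
  rewrite -big_nat_cond sum_nat_const_nat muln1 subn0.
  rewrite big_nat_cond big1 ?addn0 // => i /andP[/andP[mi _] _].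
  by rewrite ltnNge mi.
case/solv/(_ r) => -[|c' s] /= ps.
  by rewrite ffunE enum_valK ltnn.
move: ps => /andP[/existsP[u /existsP[v /and3P[_]]]].
by rewrite ffunE; case: (_ < m).
Qed.

End Moves.

Lemma min_degree_le (G : sgraph) (x : G) : min_degree G <= degree x.
Proof.
rewrite /min_degree; have := mem_index_enum x.
elim: (index_enum G) => // y s IH; rewrite in_cons big_cons.
by case/orP => [/eqP <-|/IH]; rewrite geq_min ?leqnn // => ->; rewrite orbT.
Qed.

(** * Walks and solvability in the Cartesian product *)

Section Product.
Variables G H : sgraph.

Lemma path_row (h : H) (g : G) s : path (@adj G) g s ->
  path (@adj (cart_prod G H)) (g, h) [seq (x, h) | x <- s].
Proof.
elim: s g => //= x s IH g /andP[agx /IH ->].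
by rewrite /cart_adj /= eqxx agx orbT.
Qed.

Lemma path_col (g : G) (h : H) s : path (@adj H) h s ->
  path (@adj (cart_prod G H)) (g, h) [seq (g, y) | y <- s].
Proof.
elim: s h => //= x s IH h /andP[agx /IH ->].
by rewrite /cart_adj /= eqxx agx.
Qed.

(** The image of [F] under [f] is too small to cover the neighbourhood of [x]. *)
Lemma nbr_avoiding (K : sgraph) (T : finType) (f : T -> K) (F : {set T}) x :
  #|F| < degree x -> exists2 y, adj x y & forall p, p \in F -> f p != y.
Proof.
move=> lt; have /subsetPn[y] : ~~ ([set y | adj x y] \subset f @: F).
  apply: contraL lt => /subset_leq_card; rewrite -leqNgt => /leq_trans; apply.
  exact: leq_imset_card.
rewrite inE => axy yF; exists y => // p pF; apply: contraNneq yF => <-.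
exact: imset_f.
Qed.

Lemma cart_path_avoiding a d (F : {set G * H}) (b r : G * H) :
    (forall x y : G, y \in ball predT a x) ->
    (forall x y : H, y \in ball predT d x) ->
    #|F| < degree b.2 -> #|F| < degree r.1 ->
  exists s, [/\ path (@adj (cart_prod G H)) b (rcons s r), size s <= (a + d).+1
    & {in s, forall p, p \notin F}].
Proof.
case: b r => [g h] [g' h'] /= ballG ballH Fb Fr.
have [h1 ah rowF] := nbr_avoiding snd Fb.
have [g1 ag colF] := nbr_avoiding fst Fr.
have [s [ps ls ss]] := ball_path (ballG g1 g).
have [t [pt lt st]] := ball_path (ballH h' h1).
(* One step from [b] into the row [h1], along it to the column [g1], along that to height [h']; the
   final step enters [r], which may lie in [F]. *)
exists ((g, h1) :: [seq (x, h1) | x <- s] ++ [seq (g1, y) | y <- t]); split.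
- rewrite rcons_path /= cat_path (path_row _ ps) /= last_cat.
  rewrite (last_map (fun x => (x, h1))) ls (path_col _ pt).
  rewrite (last_map (fun y => (g1, y))) lt.
  by rewrite /cart_adj /= !eqxx ah (adj_sym g1) ag orbT.
- by rewrite /= size_cat !size_map ltnS leq_add.
- move=> p; rewrite in_cons mem_cat.
  case/or3P=> [/eqP ->|/mapP[x _ ->]|/mapP[y _ ->]].
  + by apply/negP => /rowF; rewrite eqxx.
  + by apply/negP => /rowF; rewrite eqxx.
  + by apply/negP => /colF; rewrite eqxx.
Qed.

Lemma cart_all_solvable a d delta :
    (forall x y : G, y \in ball predT a x) ->
    (forall x y : H, y \in ball predT d x) ->
    (forall x : G, delta <= degree x) -> (forall x : H, delta <= degree x) ->
    2 ^ (2 * (a + d) + 2) <= delta ->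
  all_solvable (cart_prod G H) #|cart_prod G H|.
Proof.
move=> ballG ballH degG degH le_delta c cN r.
have [c0|c0] := posnP (c r); last by exists [::].
(* A big vertex in the ball of [r] gives a positive surplus there, so a pebble arrives at [r]. *)
case: (boolP [exists b : cart_prod G H, (1 < c b) &&
    (b \in ball (fun v => 0 < c v) (a + d).+2 r)]).
  case/existsP=> b /andP[cb bB].
  have [s ps le_s] := collect_ball c r (a + d).+2.
  exists s => //; have br : b != r by apply: contraTneq cb => ->; rewrite c0.
  move: le_s; rewrite (bigD1 b) /= ?bB //.
  by case: (last c s r) => //; rewrite muln0 leqn0 addn_eq0 subn_eq0 leqNgt cb.
move=> /existsPn noB.
(* Distances in the product are at most [a + d], so [2 ^ (a + d)] pebbles on one vertex suffice to
   reach [r]. *)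
have [|[x [s [ps le_s]]]|[b cb Fb]] :=
    @big_vertex_few_zeros _ c (a + d).+2 (2 ^ (a + d)) cN.
- by exists r.
- have [t [pt <- st]] : exists t,
      [/\ path (@adj (cart_prod G H)) x t, last x t = r & size t <= a + d].
    case: x r {c0 noB le_s} => [g h] [g' h'].
    have [s1 [ps1 ls1 ss1]] := ball_path (ballG g' g).
    have [t1 [pt1 lt1 st1]] := ball_path (ballH h' h).
    exists ([seq (x, h) | x <- s1] ++ [seq (g', y) | y <- t1]).
    rewrite cat_path path_row // last_cat (last_map (fun x => (x, h))) ls1.
    rewrite path_col // (last_map (fun y => (g', y))) lt1.
    by rewrite size_cat !size_map leq_add.
  apply: solvable_at_reach ps _; apply: solvable_at_path pt _.
  by apply: leq_trans le_s; rewrite leq_exp2l.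
have {}Fb : #|[set x | (c x == 0) &&
    (b \in ball (fun v => 0 < c v) (a + d).+2 x)]| < delta.
  apply: leq_trans Fb (leq_trans _ le_delta).
  by rewrite -expnD leq_exp2l //; lia.
have [s [ps ss sF]] := cart_path_avoiding ballG ballH
  (leq_trans Fb (degH b.2)) (leq_trans Fb (degG r.1)).
have subB y : ball (fun v => 0 < c v) (size s).+1 y \subset
    ball (fun v => 0 < c v) (a + d).+2 y by apply: ballW.
have /= [bB|[y [ys cy bB]]] := path_ball (fun v => 0 < c v) ps.
  have := noB b; rewrite cb /= => /negP[].
  exact: (subsetP (subB _)) bB.
(* The empty [y] is not the big vertex [b]; on [s] it would belong to the avoided set, since [b] is
   in its ball. *)
move: ys cy; rewrite in_cons => /orP[/eqP ->|/sF]; first by rewrite (ltnW cb).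
rewrite inE -leqNgt leqn0 => + cy; rewrite cy => /negP[].
exact: (subsetP (subB _)) bB.
Qed.

End Product.

(** * The degree condition with real exponent *)

Local Open Scope ring_scope.

Theorem theorem7 (R : realType) (G H : sgraph) (n delta : nat)
    (G_conn : connected_graph G) (H_conn : connected_graph H)
    (G_card : #|G| = n) (H_card : #|H| = n)
    (delta_def : delta = minn (min_degree G) (min_degree H))
    (delta_large : 2 `^ (12 * n%:R / delta%:R + 15) <= delta%:R :> R) :
  class0 (cart_prod G H).
Proof.
have delta_gt0 : (0 < delta)%N.
  by rewrite -(ltr_nat R) (lt_le_trans _ delta_large) // powR_gt0.
have degG (x : G) : (delta <= degree x)%N.
  by apply: leq_trans (min_degree_le x); rewrite delta_def geq_minl.
have degH (x : H) : (delta <= degree x)%N.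
  by apply: leq_trans (min_degree_le x); rewrite delta_def geq_minr.
split; last exact: all_solvable_lower.
apply: (cart_all_solvable (ball_diameter G_conn delta_gt0 degG)
  (ball_diameter H_conn delta_gt0 degH) degG degH).
rewrite G_card H_card -(ler_nat R) natrX -powR_mulrn //.
apply: le_trans delta_large; rewrite ler_powR ?ler1n //.
(* Each factor contributes the diameter bound [3 * (n %/ delta)], and [n %/ delta] is at most the
   real quotient. *)
have -> : (2 * (3 * (n %/ delta) + 3 * (n %/ delta)) + 2 =
           12 * (n %/ delta) + 2)%N by lia.
rewrite natrD natrM -mulrA lerD ?ler_nat // ler_wpM2l //.
by rewrite ler_pdivlMr ?ltr0n // -natrM ler_nat leq_divM.
Qed.
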